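(* Let $\varepsilon > 0$ and let $\mathcal{P}:[0,1]\to\mathbb{C}_n[t]$ be a polynomial path with $\mathcal{P}$-root-path set $\{\gamma_1, \ldots, \gamma_n\}$. Then there is a polynomial path $\mathcal{P}':[0,1]\to\mathbb{C}_n[t]$ admitting a unique $\mathcal{P}'$-root-path set $\{\gamma_1', \ldots, \gamma_n'\}$ such that $\|\mathcal{P}_\alpha - \mathcal{P}'_\alpha\| < \varepsilon$ and $|\gamma_j(\alpha) - \gamma_j'(\alpha)| < \varepsilon$ for all $\alpha \in [0,1]$ and $j=1,\ldots,n$ (for a suitable indexing of the $\gamma_j'$).
   Context: $\mathbb{C}_n[t]$ is the set of monic univariate complex polynomials of degree $n$. For a polynomial $Q=\sum_{j=0}^n a_jt^j$, $\|Q\|=\max_j|a_j|$. A polynomial path is a continuous function $\mathcal{P}:[0,1]\to\mathbb{C}_n[t]$, with value $\mathcal{P}_\alpha$ at $\alpha$. $\Sigma(Q)$ denotes the size-$n$ multiset of roots of a degree-$n$ polynomial $Q$ (with multiplicity). A $\mathcal{P}$-root-path set is a multiset $\{\gamma_1,\ldots,\gamma_n\}$ of continuous functions $[0,1]\to\mathbb{C}$ such that $\Sigma(\mathcal{P}_\alpha)=\{\gamma_1(\alpha),\ldots,\gamma_n(\alpha)\}$ as multisets for all $\alpha\in[0,1]$. Uniqueness of a root-path set is uniqueness as a multiset of functions. *)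

(* Defs.v *)
From HB Require Import structures.
From mathcomp Require Import all_boot all_order all_algebra all_fingroup.
From mathcomp Require Import all_classical all_reals all_analysis.
From mathcomp Require Export complex.
Set Implicit Arguments.
Unset Strict Implicit.
Unset Printing Implicit Defensive.
Import Order.TTheory GRing.Theory Num.Theory.
Import numFieldNormedType.Exports.
Local Open Scope classical_set_scope.
Local Open Scope ring_scope.
Local Open Scope complex_scope.

(* Functions on [0, 1] are total functions on R of which only the restriction
   to `[0, 1] is ever constrained, compared or used. *)

(* The modulus, valued in R: the norm `|z| of the numClosedFieldType R[i] is
   itself an element of R[i], equal to (cabs z)%:C. *)
Definition cabs (R : realType) (z : R[i]) : R := ComplexField.Normc.normc z.

Definition poly_norm (R : realType) (Q : {poly R[i]}) : R :=
  \big[Num.max/0]_(j < size Q) cabs Q`_j.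

Definition monic_of_degree (R : realType) (n : nat) (Q : {poly R[i]}) : Prop :=
  Q \is monic /\ size Q = n.+1.

Definition poly_path (R : realType) (n : nat) (P : R -> {poly R[i]}) : Prop :=
  (forall a : R, a \in `[0, 1] -> monic_of_degree n (P a)) /\
  (forall a : R, a \in `[0, 1] ->
     poly_norm (P b - P a) @[b --> within `[0, 1] (nbhs a)] --> (0 : R)).

(* [z] is the multiset of roots of Q, i.e. both have the same multiplicity
   function; [mup x Q] is the multiplicity of x as a root of Q. *)
Definition root_multiset (R : realType) (n : nat) (Q : {poly R[i]})
    (z : 'I_n -> R[i]) : Prop :=
  forall x : R[i], #|[set j : 'I_n | z j == x]%SET| = mup x Q.

(* A root-path set is given by an indexing of it; the multiset itself is the
   class of the indexing under [same_path_multiset]. The topology on the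
   codomain is the norm topology of the numFieldType R[i], which the library
   attaches to R[i]^o. *)
Definition root_path_set (R : realType) (n : nat) (P : R -> {poly R[i]})
    (gamma : 'I_n -> R -> R[i]) : Prop :=
  (forall j, {within `[0, 1], continuous (gamma j : R -> R[i]^o)}) /\
  (forall a : R, a \in `[0, 1] -> root_multiset (P a) (fun j => gamma j a)).

Definition same_path_multiset (R : realType) (n : nat)
    (gamma delta : 'I_n -> R -> R[i]) : Prop :=
  exists s : 'S_n, forall j (a : R), a \in `[0, 1] -> delta j a = gamma (s j) a.

Definition unique_root_path_set (R : realType) (n : nat)
    (P : R -> {poly R[i]}) (gamma : 'I_n -> R -> R[i]) : Prop :=
  root_path_set P gamma /\
  (forall delta : 'I_n -> R -> R[i],
     root_path_set P delta -> same_path_multiset gamma delta).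

(* Main.v *)
(* Replace the root paths by nearby ones that never meet. The real parts become
   pairwise distinct polynomials (Weierstrass approximation, then leading terms
   of different degrees), so that two of them agree only at finitely many times;
   adding [j * t] to the j-th imaginary part, for small [t] outside a finite set,
   separates the paths at those times. Any other root path set of the product of
   the ['X - gamma' j a] then follows a locally constant, hence constant, index.
   Coefficients are Lipschitz in the roots on bounded sets, so the polynomials
   stay close. *)

Require Import Defs.
From mathcomp Require Import all_boot all_order all_algebra all_fingroup.
From mathcomp Require Import all_classical all_reals all_analysis.
From mathcomp Require Import polyrcf ring lra.
Import Order.TTheory GRing.Theory Num.Theory.
Import numFieldNormedType.Exports.
Local Open Scope classical_set_scope.
Local Open Scope ring_scope.
Local Open Scope complex_scope.

(** * The real-valued modulus on [R[i]] *)

Lemma cabs_ge0 (R : realType) (z : R[i]) : 0 <= cabs z.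
Proof. by case: z => a b; rewrite /cabs /= sqrtr_ge0. Qed.

Lemma cabs0 (R : realType) : cabs (0 : R[i]) = 0.
Proof. exact: ComplexField.Normc.normc0. Qed.

Lemma cabs_eq0 (R : realType) (z : R[i]) : (cabs z == 0) = (z == 0).
Proof.
apply/eqP/eqP => [|->]; last exact: cabs0.
exact: ComplexField.Normc.eq0_normc.
Qed.

Lemma cabsM (R : realType) (x y : R[i]) : cabs (x * y) = cabs x * cabs y.
Proof. exact: ComplexField.Normc.normcM. Qed.

Lemma cabsN (R : realType) (x : R[i]) : cabs (- x) = cabs x.
Proof. by rewrite /cabs normcN. Qed.

Lemma cabsD (R : realType) (x y : R[i]) : cabs (x + y) <= cabs x + cabs y.
Proof. exact: le_normcD. Qed.

Lemma cabsB (R : realType) (x y : R[i]) : cabs (x - y) <= cabs x + cabs y.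
Proof. by rewrite -(cabsN _ y) cabsD. Qed.

Lemma cabsC (R : realType) (x y : R[i]) : cabs (x - y) = cabs (y - x).
Proof. by rewrite -cabsN opprB. Qed.

Lemma cabs_Re (R : realType) (z : R[i]) : `|complex.Re z| <= cabs z.
Proof.
case: z => a b; rewrite /cabs /= -sqrtr_sqr ler_sqrt ?addr_ge0 ?sqr_ge0 //.
by rewrite lerDl sqr_ge0.
Qed.

Lemma cabs_Im (R : realType) (z : R[i]) : `|complex.Im z| <= cabs z.
Proof.
case: z => a b; rewrite /cabs /= -sqrtr_sqr ler_sqrt ?addr_ge0 ?sqr_ge0 //.
by rewrite lerDr sqr_ge0.
Qed.

Lemma cabs_le_ReIm (R : realType) (x y : R) : cabs (x +i* y) <= `|x| + `|y|.
Proof.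
rewrite /cabs /= -[leRHS]ger0_norm ?addr_ge0 // -sqrtr_sqr.
rewrite ler_sqrt ?sqr_ge0 // sqrrD !real_normK ?num_real //.
by rewrite lerD2r lerDl mulrn_wge0 ?mulr_ge0.
Qed.

Lemma cabs_real (R : realType) (x : R) : cabs x%:C = `|x|.
Proof. by rewrite /cabs /= expr0n addr0 sqrtr_sqr. Qed.

Lemma normr_cabs (R : realType) (z : R[i]) : `|z| = (cabs z)%:C.
Proof. by rewrite normc_def; case: z. Qed.

(** * Continuity and compactness on the unit segment *)

(** Tolerances in [R[i]^o] are elements of [R[i]], but a positive one has zero imaginary part, so
    real tolerances suffice. *)
Lemma within_continuous_cabsP (R : realType) (A : set R) (f : R -> R[i]) :
  {within A, continuous (f : R -> R[i]^o)} <->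
  forall a, A a -> forall e : R, 0 < e ->
    \forall b \near within A (nbhs a), cabs (f b - f a) < e.
Proof.
rewrite subspace_continuousP; split=> fc a Aa.
  move=> e e0; move/(_ a Aa)/cvgrPdist_lt : fc => /(_ e%:C).
  rewrite ltcR => /(_ e0); apply: filterS => b.
  by rewrite normr_cabs ltcR cabsC.
apply/cvgrPdist_lt => -[e e'].
rewrite ltcE /= => /andP[/eqP -> e0]; move: (fc a Aa e e0).
by apply: filterS => b; rewrite normr_cabs cabsC -/(real_complex _ e) ltcR.
Qed.

(** Near each [x], every [M] above [cabs (f x) + 1] is a bound; compactness, as a near-covering
    property, makes one [M] serve the whole segment. *)
Lemma within_continuous_bounded (R : realType) (f : R -> R[i]) :
  {within `[0, 1], continuous (f : R -> R[i]^o)} ->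
  exists M : R, forall a, a \in `[0, 1] -> cabs (f a) <= M.
Proof.
move=> /within_continuous_cabsP fc.
have /compact_near_coveringP/near_covering_withinP := @segment_compact R 0 1.
move=> /(_ R +oo (fun M a => cabs (f a) <= M) _) H.
have {H} : \forall M \near +oo, `[0, 1] `<=` (fun a => cabs (f a) <= M).
  apply: H => x x01.
  exists ((fun a => a \in `[0, 1] -> cabs (f a - f x) < 1),
    [set M | cabs (f x) + 1 <= M]).
    by split; [exact: fc|apply: nbhs_pinfty_ge; rewrite num_real].
  move=> [a M] /= [af fM] a01; move: (af a01) (cabsD R (f a - f x) (f x)).
  rewrite subrK; lra.
by move=> /filter_ex[M MP]; exists M => a /MP.
Qed.

(** The same near-covering argument with [d] tending to [0] from the right: if [f] stays within
    [e / 2] of [f x] at radius [r], every [d < r / 2] works for all points within [r / 2] of [x]. *)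
Lemma within_uniformly_continuous (R : realType) (f : R -> R[i]) (e : R) :
  {within `[0, 1], continuous (f : R -> R[i]^o)} -> 0 < e ->
  exists2 d : R, 0 < d & forall x y, x \in `[0, 1] -> y \in `[0, 1] ->
    `|x - y| < d -> cabs (f x - f y) < e.
Proof.
move=> /within_continuous_cabsP fc e0.
have /compact_near_coveringP/near_covering_withinP := @segment_compact R 0 1.
move=> /(_ R 0^'+ (fun d x => forall y, y \in `[0, 1] -> `|x - y| < d ->
  cabs (f x - f y) < e) _) H.
have {H} : \forall d \near 0^'+, `[0, 1] `<=` (fun x => forall y,
    y \in `[0, 1] -> `|x - y| < d -> cabs (f x - f y) < e).
  apply: H => x x01.
  have e20 : 0 < e / 2 by lra.
  have /nbhs_ballP[r /= r0 xr] := fc x x01 _ e20.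
  exists (ball x (r / 2), [set d | d < r / 2]).
    split; first by apply: nbhsx_ballx; lra.
    by apply: nbhs_right_lt; lra.
  move=> [a d] /= [+ dr] a01 y y01; rewrite /ball /= => xa ay.
  have xy : `|x - y| < r.
    by have := ler_distD a x y; lra.
  have fa : cabs (f a - f x) < e / 2 by apply: xr => //; rewrite /ball /=; lra.
  have fy : cabs (f y - f x) < e / 2 by apply: xr.
  have -> : f a - f y = (f a - f x) - (f y - f x) by ring.
  by have := cabsB R (f a - f x) (f y - f x); lra.
move=> dP; near (0:R)^'+ => d; exists d => //.
by move=> x y x01; apply: (near dP d) => //.
Unshelve. all: by end_near. Qed.

(** The indicator of [k b = k 0] is continuous, so by the intermediate value theorem a drop from 1
    to 0 would force the value [1 / 2]. *)
Lemma locally_constant_on_segment (R : realType) (T : choiceType) (k : R -> T) :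
  (forall a : R, a \in `[0, 1] ->
    \forall b \near within `[0, 1] (nbhs a), k b = k a) ->
  forall a : R, a \in `[0, 1] -> k a = k 0.
Proof.
move=> kc a a01; apply/eqP/negPn/negP => kab.
pose f b : R := (k b == k 0)%:R.
have fc : {within `[0, 1], continuous f}.
  apply/subspace_continuousP => x x01; apply: cvg_near_cst.
  by apply: filterS (kc x x01) => b; rewrite /from_subspace /f => ->.
have a1 : `[0, a] `<=` `[0, 1].
  by apply: subset_itvl; rewrite bnd_simp; move: a01; rewrite in_itv/= => /andP[].
have fac := continuous_subspaceW a1 fc.
have [||c _] := @IVT R f 0 a (1 / 2) _ fac.
- by move: a01; rewrite in_itv/= => /andP[].
- by rewrite /f eqxx (negPf kab) min_r ?max_l ?ler01 //=; lra.
by rewrite /f; case: (_ == _) => /=; lra.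
Qed.

(** * Weierstrass approximation by Bernstein polynomials *)

(* [g k] is the value at the k-th node; the recursion is Pascal's rule for
   \sum_k g k * 'C(N, k) * 'X^k * (1 - 'X)^(N - k). *)
Fixpoint bernstein {R : nzRingType} (N : nat) (g : nat -> R) : {poly R} :=
  if N is N'.+1 then
    'X * bernstein N' (fun k => g k.+1) + (1 - 'X) * bernstein N' g
  else (g 0%N)%:P.

(** The bound is the mean of [A + C * (S - m) ^+ 2] for [S] binomial with parameters [N] and [x], as
    in Chebyshev's inequality. The centre [m] is left free because shifting [g] in the recursion
    turns [m] into [m - 1]. *)
Lemma bernstein_dist (R : realType) (N : nat) (g : nat -> R) (x c A C m : R) :
  0 <= x <= 1 ->
  (forall k, (k <= N)%N -> `|g k - c| <= A + C * (k%:R - m) ^+ 2) ->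
  `|(bernstein N g).[x] - c|
    <= A + C * ((N%:R * x - m) ^+ 2 + N%:R * x * (1 - x)).
Proof.
move=> /andP[x0 x1]; elim: N g m => [|N IH] g m gP /=.
  rewrite hornerC (le_trans (gP 0%N _)) //; lra.
rewrite !hornerE.
have /IH H1 : forall k, (k <= N)%N ->
    `|g k.+1 - c| <= A + C * (k%:R - (m - 1)) ^+ 2.
  move=> k kN; apply: le_trans (gP k.+1 _) _ => //.
  by rewrite -natr1; lra.
have /IH H2 : forall k, (k <= N)%N -> `|g k - c| <= A + C * (k%:R - m) ^+ 2.
  by move=> k kN; apply: gP; apply: leqW.
set a := (bernstein N _).[x] in H1 *; set b := (bernstein N g).[x] in H2 *.
have -> : x * a + (1 - x) * b - c = x * (a - c) + (1 - x) * (b - c) by ring.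
apply: le_trans (ler_normD _ _) _.
rewrite !normrM (ger0_norm x0) [`|1 - x|]ger0_norm; last by lra.
apply: le_trans (lerD (ler_wpM2l x0 H1) (ler_wpM2l _ H2)) _; first by lra.
by rewrite -natr1; lra.
Qed.

Lemma weierstrass_approx (R : realType) (f : R -> R) (e : R) :
  {within `[0, 1], continuous f} -> 0 < e ->
  exists p : {poly R}, forall x, x \in `[0, 1] -> `|f x - p.[x]| <= e.
Proof.
move=> fc e0; have e20 : 0 < e / 2 by lra.
(* Embedding [f] in [R[i]] makes the two compactness lemmas applicable. *)
have Fc : {within `[0, 1], continuous ((fun x => (f x)%:C) : R -> R[i]^o)}.
  apply/within_continuous_cabsP => a a01 r r0.
  move/subspace_continuousP : fc => /(_ a a01)/cvgrPdist_lt/(_ r r0).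
  by apply: filterS => b; rewrite -rmorphB cabs_real distrC.
have [d d0 fd] : exists2 d : R, 0 < d & forall x y, x \in `[0, 1] ->
    y \in `[0, 1] -> `|x - y| < d -> `|f x - f y| <= e / 2.
  have [d d0 dP] := within_uniformly_continuous _ _ _ Fc e20.
  exists d => // x y x01 y01 /(dP _ _ x01 y01).
  by rewrite -rmorphB cabs_real => /ltW.
have [M fM] : exists M : R, forall x, x \in `[0, 1] -> `|f x| <= M.
  have [M MP] := within_continuous_bounded _ _ Fc.
  by exists M => x /MP; rewrite cabs_real.
have M0 : 0 <= M.
  by apply: le_trans (normr_ge0 _) (fM 0 _); rewrite in_itv/= lexx ler01.
(* Since [K * e / 2] is [2 * M / d ^+ 2], taking [n >= K] brings the variance term below [e / 2]. *)
pose K := 4 * M / (d ^+ 2 * e).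
have K0 : 0 <= K.
  by apply: divr_ge0; apply: mulr_ge0; rewrite ?sqr_ge0 // ltW.
have [N KN] : exists N : nat, K <= N.+1%:R.
  by exists (Num.truncn K); apply/ltW/truncnS_gt.
exists (bernstein N.+1 (fun k => f (k%:R / N.+1%:R))) => x x01.
have N0 : 0 < N.+1%:R :> R by rewrite ltr0n.
have x01' : 0 <= x <= 1 by move: x01; rewrite in_itv.
rewrite distrC.
(* Centring at [n * x] leaves only the variance. Nodes closer to [x] than [d] cost [e / 2]; at the
   others the crude bound [2 * M] is absorbed by the quadratic term, the distance being at least
   [d]. *)
apply: le_trans (@bernstein_dist R N.+1 (fun k => f (k%:R / N.+1%:R)) x (f x)
  (e / 2) (2 * M / (d * N.+1%:R) ^+ 2) (N.+1%:R * x) x01' _) _;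
  set n := N.+1%:R in N0 KN *.
  move=> k kN; set y := k%:R / n.
  have y01 : y \in `[0, 1].
    by rewrite in_itv/= /y divr_ge0 ?ler0n//= ler_pdivrMr// mul1r ler_nat.
  have [xy|xy] := ltP `|y - x| d.
    apply: le_trans (fd _ _ y01 x01 xy) _.
    by rewrite lerDl mulr_ge0 ?sqr_ge0 // divr_ge0 ?sqr_ge0 // mulr_ge0.
  have -> : k%:R - n * x = n * (y - x) by rewrite /y; field; exact: lt0r_neq0.
  apply: (@le_trans _ _ (2 * M)).
    by have := ler_normB (f y) (f x); have := fM _ x01; have := fM _ y01; lra.
  have -> : 2 * M / (d * n) ^+ 2 * (n * (y - x)) ^+ 2
      = 2 * M * (`|y - x| / d) ^+ 2.
    rewrite [(_ / d) ^+ 2]expr_div_n real_normK ?num_real //.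
    by field; rewrite !lt0r_neq0.
  apply: (@le_trans _ _ (2 * M * (`|y - x| / d) ^+ 2)); last by lra.
  rewrite ler_peMr ?mulr_ge0 // exprn_ege1 //.
  by rewrite ler_pdivlMr// mul1r.
have -> : (n * x - n * x) ^+ 2 + n * x * (1 - x) = n * (x * (1 - x)) by ring.
have -> : 2 * M / (d * n) ^+ 2 * (n * (x * (1 - x)))
    = (K * e / 2) / n * (x * (1 - x)).
  by rewrite /K; field; rewrite !lt0r_neq0.
have t1 : x * (1 - x) <= 1 by case/andP: x01' => *; nra.
have t0 : 0 <= x * (1 - x) by case/andP: x01' => *; nra.
have Kn0 : 0 <= K * e / 2 / n.
  apply: divr_ge0; last exact: ltW.
  by apply: divr_ge0 => //; apply: mulr_ge0 => //; exact: ltW.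
have Kn1 : K * e / 2 / n <= e / 2.
  by rewrite ler_pdivrMr//; nra.
by rewrite [leRHS]splitr lerD2l; exact: le_trans (ler_piMr Kn0 t1) Kn1.
Qed.

(** * Polynomials with prescribed roots and their coefficients *)

Definition root_poly {R : realType} {n : nat} (z : 'I_n -> R[i]) : {poly R[i]} :=
  \prod_(j < n) ('X - (z j)%:P).

Lemma card_root_count (R : realType) (n : nat) (z : 'I_n -> R[i]) (x : R[i]) :
  #|[set j : 'I_n | z j == x]%SET| = count_mem x [seq z j | j : 'I_n].
Proof. by rewrite cardsE -sum1_card -sum1_count big_map big_enum_cond. Qed.

Lemma root_polyE (R : realType) (n : nat) (z : 'I_n -> R[i]) :
  root_poly z = \prod_(x <- [seq z j | j : 'I_n]) ('X - x%:P).
Proof. by rewrite big_map big_enum. Qed.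

Lemma root_multiset_root_poly (R : realType) (n : nat) (z : 'I_n -> R[i]) :
  root_multiset (root_poly z) z.
Proof. by move=> x; rewrite card_root_count root_polyE mu_prod_XsubC. Qed.

(** A monic polynomial splits over the algebraically closed [R[i]]; equal multiplicities make its
    list of roots a permutation of the [z j]. *)
Lemma root_multiset_eq_root_poly (R : realType) (n : nat) (Q : {poly R[i]})
    (z : 'I_n -> R[i]) :
  Q \is monic -> root_multiset Q z -> Q = root_poly z.
Proof.
move=> /monicP Qm Qz; have [r] := closed_field_poly_normal Q.
rewrite Qm scale1r => Qr; rewrite Qr root_polyE; apply: perm_big.
apply/allP => x _ /=.
by rewrite -mu_prod_XsubC -Qr -Qz card_root_count.
Qed.

Lemma monic_of_degree_root_poly (R : realType) (n : nat) (z : 'I_n -> R[i]) :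
  monic_of_degree n (root_poly z).
Proof.
split; first exact: monic_prod_XsubC.
by rewrite root_polyE size_prod_XsubC size_map -cardE card_ord.
Qed.

(** A linear factor shifts the coefficients and subtracts [x] times them. This is the inductive step
    of the next two bounds. *)
Lemma coef_XsubCM_le (R : realType) (M A : R) (x : R[i]) (Q : {poly R[i]}) :
  cabs x <= M -> (forall i, cabs Q`_i <= A) ->
  forall i, cabs (('X - x%:P) * Q)`_i <= (1 + M) * A.
Proof.
move=> xM QA i; rewrite mulrBl coefB coefXM coefCM.
apply: le_trans (cabsB _ _ _) _; rewrite mulrDl mul1r lerD //.
  (* At index [0] the shifted coefficient is [0], and [A] is nonnegative because it bounds a
     modulus. *)
  case: (i == 0%N) => //; rewrite cabs0; exact: le_trans (cabs_ge0 _ _) (QA 0%N).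
by rewrite cabsM ler_pM ?cabs_ge0.
Qed.

Lemma coef_root_poly_le (R : realType) (n : nat) (M : R) (z : 'I_n -> R[i]) :
  0 <= M -> (forall j, cabs (z j) <= M) ->
  forall i, cabs (root_poly z)`_i <= (1 + M) ^+ n.
Proof.
rewrite /root_poly => M0; elim: n z => [|n IH] z zM i.
  rewrite big_ord0 coef1 expr0; case: (i == 0%N).
    by rewrite mulr1n /cabs ComplexField.Normc.normc1.
  by rewrite mulr0n cabs0.
rewrite big_ord_recl exprS; apply: coef_XsubCM_le => //.
by apply: IH.
Qed.

(** Roots are exchanged one at a time; each exchange costs at most [d] times a bound on the
    coefficients of the remaining product, and all powers of [1 + M] are rounded up to the
    [n]-th. *)
Lemma coef_root_poly_dist (R : realType) (n : nat) (M d : R)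
    (z w : 'I_n -> R[i]) :
  0 <= M -> (forall j, cabs (z j) <= M) -> (forall j, cabs (w j) <= M) ->
  (forall j, cabs (z j - w j) <= d) ->
  forall i, cabs (root_poly z - root_poly w)`_i <= n%:R * (1 + M) ^+ n * d.
Proof.
rewrite /root_poly => M0; elim: n z w => [|n IH] z w zM wM zw i.
  by rewrite !big_ord0 subrr coef0 cabs0 !mul0r.
rewrite !big_ord_recl; set A := \prod_(_ < n) _; set B := \prod_(_ < n) _.
have -> : ('X - (z ord0)%:P) * A - ('X - (w ord0)%:P) * B
    = ('X - (z ord0)%:P) * (A - B) + (w ord0 - z ord0)%:P * B.
  by rewrite polyCB; ring.
rewrite coefD coefCM; apply: le_trans (cabsD _ _ _) _.
have d0 : 0 <= d by apply: le_trans (cabs_ge0 _ _) (zw ord0).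
have {}IH : forall i, cabs (A - B)`_i <= n%:R * (1 + M) ^+ n * d by apply: IH.
have H1 := coef_XsubCM_le R _ _ _ _ (zM ord0) IH i.
have Bi : cabs B`_i <= (1 + M) ^+ n.
  by apply: (coef_root_poly_le R n M _ M0) => j.
have H2 : cabs ((w ord0 - z ord0) * B`_i) <= d * (1 + M) ^+ n.
  by rewrite cabsM ler_pM ?cabs_ge0 // cabsC.
have H3 : (1 + M) ^+ n * d <= (1 + M) ^+ n * d * (1 + M).
  by rewrite ler_peMr ?mulr_ge0 ?exprn_ge0 ?addr_ge0 // lerDl.
apply: le_trans (lerD H1 H2) _; rewrite exprS -natr1; lra.
Qed.

Lemma poly_norm_lt (R : realType) (Q : {poly R[i]}) (e : R) :
  0 < e -> (forall i, cabs Q`_i < e) -> poly_norm Q < e.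
Proof. by move=> e0 Qe; apply: bigmax_lt. Qed.

Lemma poly_norm_ge0 (R : realType) (Q : {poly R[i]}) : 0 <= poly_norm Q.
Proof. exact: bigmax_ge_id. Qed.

(** * Uniqueness for separated paths, and separation of given paths *)

Lemma exists_pos_avoiding (R : realType) (s : seq R) (e : R) :
  0 < e -> exists2 t, 0 < t <= e & t \notin s.
Proof.
move=> e0.
(* Lying below every positive entry is stronger than avoiding [s], and passes through the
   induction. *)
suff [t /andP[t0 te] ts] : exists2 t, 0 < t <= e &
    {in s, forall y, 0 < y -> t < y}.
  by exists t; rewrite ?t0 //; apply/negP => /ts /(_ t0); rewrite ltxx.
elim: s => [|y s [t /andP[t0 te] ts]]; first by exists e; rewrite ?e0 ?lexx.
have [y0|y0] := ltP 0 y; last first.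
  by exists t; rewrite ?t0 // => u; rewrite inE => /predU1P[->|/ts //]; lra.
have [ty|yt] := ltP t y.
  by exists t; rewrite ?t0 // => u; rewrite inE => /predU1P[->|/ts //].
exists (y / 2); first by apply/andP; split; lra.
move=> u; rewrite inE => /predU1P[->|/ts H u0]; first by lra.
by have := H u0; lra.
Qed.

Lemma separated_paths_unique (R : realType) (n : nat) (g : 'I_n -> R -> R[i]) :
  (forall j, {within `[0, 1], continuous (g j : R -> R[i]^o)}) ->
  (forall a i j, a \in `[0, 1] -> g i a = g j a -> i = j) ->
  unique_root_path_set (fun a => root_poly (g^~ a)) g.
Proof.
move=> gc ginj; split; first by split=> // a _; exact: root_multiset_root_poly.
move=> delta [dc droot].
have mult a i : a \in `[0, 1] -> #|[set j : 'I_n | delta j a == g i a]%SET| = 1%N.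
  move=> a01; rewrite (droot a a01) -root_multiset_root_poly -(cards1 i).
  congr #|pred_of_set _|; apply/setP => j; rewrite !inE.
  by apply/eqP/eqP => [/(ginj _ _ _ a01)|->].
have /choice[k kP] (j : 'I_n) : exists k : R -> 'I_n,
    forall a, a \in `[0, 1] -> delta j a = g (k a) a.
  suff /choice[k kP] :
      forall a, exists i, a \in `[0, 1] -> delta j a = g i a.
    by exists k.
  (* Outside the segment the index is arbitrary; [j] serves as default. *)
  move=> a; have [a01|_] := boolP (a \in `[0, 1]); last by exists j.
  have : (0 < #|[set i : 'I_n | g i a == delta j a]%SET|)%N.
    rewrite (root_multiset_root_poly _ _ (g^~ a)) -(droot a a01).
    by apply/card_gt0P; exists j; rewrite inE.
  by case/card_gt0P => i; rewrite inE => /eqP gi; exists i.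
have kc j a : a \in `[0, 1] -> k j a = k j 0.
  move: a; apply: locally_constant_on_segment => a a01.
  (* A path [g l] other than the one followed at [a] is at positive distance from [delta j a];
     within half that distance on each side the two cannot meet. There are finitely many [l], so one
     neighbourhood serves all. *)
  have H (l : 'I_n) : \forall b \near within `[0, 1] (nbhs a),
      k j a != l -> delta j b != g l b.
    have [_|kl] := eqVneq (k j a) l; first by apply: nearW.
    pose e := cabs (delta j a - g l a) / 2.
    have e0 : 0 < e.
      rewrite divr_gt0 // lt_def cabs_ge0 andbT cabs_eq0 subr_eq0 kP //.
      by apply: contra kl => /eqP/(ginj _ _ _ a01) ->.
    move/within_continuous_cabsP : (dc j) => /(_ a a01 e e0).
    move/within_continuous_cabsP : (gc l) => /(_ a a01 e e0).
    apply: filterS2 => b gb db _; apply/eqP => dg.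
    have := cabsB R (g l b - g l a) (delta j b - delta j a).
    have -> : g l b - g l a - (delta j b - delta j a) = delta j a - g l a.
      by rewrite dg; ring.
    by move: gb db; rewrite /e; lra.
  have /filter_forall {}H := H.
  have : \forall b \near within `[0, 1] (nbhs a), b \in `[0, 1].
    exact: near_withinT.
  near_simpl; apply: filterS2 H => b bP b01; apply/eqP.
  by apply: contraT; rewrite eq_sym => /bP; rewrite (kP j b) // eqxx.
have zero01 : (0 : R) \in `[0, 1] by rewrite in_itv/= lexx ler01.
(* Two [delta] following the same path would make a simple root at time [0] double. *)
have kinj : injective (fun j => k j 0).
  move=> i j kij; apply/set1P.
  have /eqP/cards1P[l kl] := mult 0 (k j 0) zero01.
  have : i \in [set j' | delta j' 0 == g (k j 0) 0]%SET by rewrite inE kP // kij.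
  have : j \in [set j' | delta j' 0 == g (k j 0) 0]%SET by rewrite inE kP.
  by rewrite kl !inE => /eqP -> /eqP ->.
exists (perm kinj) => j a a01; by rewrite permE kP // kc.
Unshelve. all: by end_near. Qed.

Lemma separate_paths (R : realType) (n : nat) (f : 'I_n -> R -> R[i]) (d : R) :
  0 < d ->
  (forall j, {within `[0, 1], continuous (f j : R -> R[i]^o)}) ->
  exists g : 'I_n -> R -> R[i],
    [/\ forall j, {within `[0, 1], continuous (g j : R -> R[i]^o)},
        forall a i j, a \in `[0, 1] -> g i a = g j a -> i = j
      & forall a j, a \in `[0, 1] -> cabs (f j a - g j a) <= d].
Proof.
move=> d0 fc.
have d40 : 0 < d / 4 by lra.
have /choice[p pP] (j : 'I_n) : exists p : {poly R},
    forall x, x \in `[0, 1] -> `|complex.Re (f j x) - p.[x]| <= d / 4.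
  apply: weierstrass_approx => //; apply/subspace_continuousP => a a01.
  apply/cvgrPdist_lt => r r0.
  move/within_continuous_cabsP : (fc j) => /(_ a a01 r r0).
  apply: filterS => b; apply: le_lt_trans.
  by rewrite distrC -raddfB cabs_Re.
pose m := (\max_j size (p j))%N.
(* As [m] bounds every [size (p j)], the added monomial dominates and the degrees [m + j] are
   distinct. On the segment it costs at most [d / 4]. *)
pose q j := p j + (d / 4) *: 'X^(m + j).
have size_q j : size (q j) = (m + j).+1.
  have sX : size ((d / 4) *: 'X^(m + j) : {poly R}) = (m + j).+1.
    by rewrite size_scale ?lt0r_neq0 // size_polyXn.
  rewrite /q addrC size_polyDl sX // ltnS (leq_trans _ (leq_addr _ _)) //.
  exact: (leq_bigmax j).
have q_inj i j : i != j -> q i - q j != 0.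
  apply: contra; rewrite subr_eq0 => /eqP qij; apply/eqP/val_inj.
  by have := size_q i; rewrite qij size_q => -[/addnI].
have qP j x : x \in `[0, 1] -> `|complex.Re (f j x) - (q j).[x]| <= d / 2.
  move=> x01; have := pP j x x01; rewrite /q hornerD hornerZ hornerXn opprD addrA.
  set u := complex.Re _ - _ => ud; apply: le_trans (ler_normB _ _) _.
  have /andP[x0 x1] : 0 <= x <= 1 by move: x01; rewrite in_itv.
  have : `|d / 4 * x ^+ (m + j)| <= d / 4.
    have y0 : 0 <= x ^+ (m + j) by exact: exprn_ge0.
    have y1 : x ^+ (m + j) <= 1 by exact: exprn_ile1.
    rewrite ger0_norm; last by rewrite mulr_ge0 // ltW.
    by rewrite ler_piMr // ltW.
  by lra.
(* The shifts to avoid: at a common value [x] of two real parts, the imaginary parts meet when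
   [Im (f i x) + i * t = Im (f j x) + j * t], which is solved for [t]. *)
pose s := flatten [seq [seq (complex.Im (f ij.1 x) - complex.Im (f ij.2 x)) /
    ((ij.2 : nat)%:R - (ij.1 : nat)%:R) | x <- rootsR (q ij.1 - q ij.2)]
  | ij : 'I_n * 'I_n].
have n0 : 0 < n.+1%:R :> R by rewrite ltr0n.
(* Dividing by [n.+1] keeps every [j * t] below [d / 4] and is safe for [n = 0]. *)
have [t /andP[t0 td] ts] := exists_pos_avoiding R s _ (divr_gt0 d40 n0).
have jt : forall j : 'I_n, `|(j : nat)%:R * t| <= d / 4.
  move=> j; rewrite ger0_norm; last by rewrite mulr_ge0 // ltW.
  apply: le_trans (ler_wpM2l _ td) _ => //.
  rewrite mulrCA ler_piMr ?(ltW d40) // ler_pdivrMr // mul1r ler_nat.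
  exact: leqW (ltnW (ltn_ord j)).
exists (fun j a => (q j).[a] +i* (complex.Im (f j a) + (j : nat)%:R * t)); split.
- move=> j; apply/within_continuous_cabsP => a a01 e e0.
  have e20 : 0 < e / 2 by lra.
  have : \forall b \near within `[0, 1] (nbhs a),
      `|(q j).[a] - (q j).[b]| < e / 2.
    apply: cvg_within.
    by have /cvgrPdist_lt/(_ _ e20) := @continuous_horner R (q j) a.
  move/within_continuous_cabsP : (fc j) => /(_ a a01 _ e20).
  apply: filterS2 => b fb qb.
  apply: le_lt_trans (cabs_le_ReIm _ _ _) _.
  have := cabs_Im R (f j b - f j a); rewrite raddfB /=.
  have -> : complex.Im (f j b) + j%:R * t - (complex.Im (f j a) + j%:R * t) =
    complex.Im (f j b) - complex.Im (f j a) by ring.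
  by rewrite [`|(q j).[b] - _|]distrC; lra.
- move=> a i j a01 [qij fij]; apply/eqP; apply: contraT => ij; case/negP: ts.
  apply/flatten_mapP; exists (i, j); first by rewrite mem_enum.
  apply/mapP; exists a => /=.
    rewrite -(roots_on_rootsR (q_inj _ _ ij)) in_itv /=.
    by rewrite /root hornerD hornerN qij subrr.
  have ij0 : (j : nat)%:R - (i : nat)%:R != 0 :> R.
    rewrite subr_eq0 eqr_nat; apply: contra ij => /eqP ij.
    by apply/eqP/val_inj.
  have -> : complex.Im (f i a) - complex.Im (f j a)
      = ((j : nat)%:R - (i : nat)%:R) * t by lra.
  by rewrite mulrC mulKf.
move=> a j a01; have := qP j a a01; have := jt j.
case: (f j a) => u v /= jtd quv.
apply: le_trans (cabs_le_ReIm _ _ _) _.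
by rewrite opprD addNKr normrN; lra.
Qed.

(** * Continuity of the new polynomial path, and the conclusion *)

Lemma poly_path_root_poly (R : realType) (n : nat) (g : 'I_n -> R -> R[i]) :
  (forall j, {within `[0, 1], continuous (g j : R -> R[i]^o)}) ->
  poly_path n (fun a => root_poly (g^~ a)).
Proof.
move=> gc; split=> a a01; first exact: monic_of_degree_root_poly.
have /choice[M MP] j := within_continuous_bounded R (g j) (gc j).
pose N := \sum_j `|M j|.
have gN j b : b \in `[0, 1] -> cabs (g j b) <= N.
  move=> /MP/le_trans; apply; rewrite /N (bigD1 j) //=.
  by rewrite (le_trans (ler_norm _)) // lerDl sumr_ge0.
have N0 : 0 <= N by apply: sumr_ge0.
pose K := n%:R * (1 + N) ^+ n.
have K0 : 0 <= K by rewrite mulr_ge0 // exprn_ge0 // addr_ge0.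
apply/cvgr0Pnorm_lt => e e0.
(* [K] is the Lipschitz constant of the coefficients for roots bounded by [N]; adding 1 avoids a
   zero denominator and makes the final bound strict. *)
have eK0 : 0 < e / (K + 1) by rewrite divr_gt0 // ltr_wpDl.
have H (j : 'I_n) : \forall b \near within `[0, 1] (nbhs a),
    cabs (g j b - g j a) < e / (K + 1).
  by move/within_continuous_cabsP : (gc j); apply.
have /filter_forall {}H := H.
have B : \forall b \near within `[0, 1] (nbhs a), b \in `[0, 1].
  exact: near_withinT.
near_simpl; apply: filterS2 H B => b bP b01.
rewrite ger0_norm ?poly_norm_ge0 //; apply: poly_norm_lt => // i.
apply: le_lt_trans (coef_root_poly_dist R n N (e / (K + 1)) _ _ N0 _ _ _ i) _.
- by move=> j; apply: gN.
- by move=> j; apply: gN.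
- by move=> j; apply: ltW.
by rewrite -/K mulrA ltr_pdivrMr ?ltr_wpDl // mulrC ltr_pM2l // ltrDl.
Unshelve. all: by end_near. Qed.

Theorem theorem6 (R : realType) (n : nat) (eps : R) (P : R -> {poly R[i]})
    (gamma : 'I_n -> R -> R[i]) :
  0 < eps ->
  poly_path n P ->
  root_path_set P gamma ->
  exists (P' : R -> {poly R[i]}) (gamma' : 'I_n -> R -> R[i]),
    [/\ poly_path n P',
        unique_root_path_set P' gamma',
        forall a : R, a \in `[0, 1] -> poly_norm (P a - P' a) < eps
      & forall (a : R) (j : 'I_n), a \in `[0, 1] ->
          cabs (gamma j a - gamma' j a) < eps].
Proof.
move=> eps0 [Pmonic _] [gc groot].
have /choice[M MP] j := within_continuous_bounded R (gamma j) (gc j).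
(* The extra [eps] leaves room for the perturbed paths under the same bound [N]. *)
pose N := \sum_j `|M j| + eps.
have gN j b : b \in `[0, 1] -> cabs (gamma j b) <= N - eps.
  move=> /MP/le_trans; apply; rewrite /N addrK (bigD1 j) //=.
  by rewrite (le_trans (ler_norm _)) // lerDl sumr_ge0.
have N0 : 0 <= N by apply: addr_ge0; [exact: sumr_ge0 | exact: ltW].
pose K := n%:R * (1 + N) ^+ n.
have K0 : 0 <= K by rewrite mulr_ge0 // exprn_ge0 // addr_ge0.
have K20 : 0 < K + 2 by lra.
(* This gives both [K * d < eps] for coefficients and [d < eps] for roots, the latter strictly even
   when [K = 0]. *)
pose d := eps / (K + 2).
have d0 : 0 < d by rewrite divr_gt0.
have d_lt : d < eps.
  rewrite ltr_pdivrMr //; have := mulr_ge0 (ltW eps0) K0; lra.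
have [g [gc' ginj gd]] := separate_paths R n gamma d d0 gc.
exists (fun a => root_poly (g^~ a)), g; split.
- exact: poly_path_root_poly.
- exact: separated_paths_unique.
- move=> a a01; have [Pm _] := Pmonic a a01.
  rewrite (root_multiset_eq_root_poly R n (P a) _ Pm (groot a a01)).
  apply: poly_norm_lt => // i.
  apply: le_lt_trans (coef_root_poly_dist R n N d _ _ N0 _ _ _ i) _.
  + by move=> j; have := gN j a a01; lra.
  + move=> j; have := gN j a a01; have := gd a j a01.
    have := cabsB R (gamma j a) (gamma j a - g j a).
    by rewrite subKr; lra.
  + by move=> j; apply: gd.
  rewrite -/K /d mulrA ltr_pdivrMr // mulrC ltr_pM2l //; lra.
by move=> a j a01; apply: le_lt_trans (gd a j a01) d_lt.
Qed.
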